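(* Let $F=(F_1,\dots,F_m):\mathbb{R}^n\to\mathbb{R}^m$ be twice continuously differentiable and let $\{x_k\}$ be an infinite sequence of points, none of which is Pareto critical, produced by the generic variable metric method (GVMM) from a starting point $x_0\in\mathbb{R}^n$, with associated matrices $\{B_k\}$ and dual solutions $\{\lambda^k\}$. Suppose that (1) there exist constants $a,b>0$ such that $aI\leqslant B_k\leqslant bI$ for all $k$; (2) for any $x_0\in\mathbb{R}^n$, the level set $\{x\in\mathbb{R}^n: F(x)\leqslant F(x_0)\}$ is compact; (3) $\{x_k\}$ possesses an accumulation point $x^*$ with a corresponding multiplier $\lambda^*$ (i.e. $\lambda^*\in\Delta_m$ and $\sum_{i=1}^m\lambda_i^*\nabla F_i(x^* )=0$) such that $$d^{\mathrm T}\Big(\sum_{i=1}^m\lambda_i^*\nabla^2F_i(x^* )\Big)d>0\quad\text{for all } d\in\Omega,$$ where $\Omega=\{d\in\mathbb{R}^n\setminus\{0\}:\nabla F_i(x^* )^{\mathrm T}d=0,\ i=1,\dots,m\}$; (4) the vectors $\{\nabla F_i(x^* ): i\in\mathcal{A}(x^* )\}$ are affinely independent, where $\mathcal{A}(x^* )=\{i:\nabla F_i(x^* )^{\mathrm T}d(x^* )=t(x^* )\}$ is the set of active constraints at $x^*$. Then $\lim_{k\to\infty}\lambda^k=\lambda^*$.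
   Context: For vectors, $F(y)\leqslant F(z)$ is meant componentwise. For symmetric matrices, $A\leqslant B$ means $B-A$ is positive semidefinite. $JF(x)\in\mathbb{R}^{m\times n}$ is the Jacobian of $F$ at $x$, and $\nabla F_i(x)$, $\nabla^2F_i(x)$ are the gradient and Hessian of $F_i$. $\Delta_m=\{\lambda\in\mathbb{R}^m:\sum_{i=1}^m\lambda_i=1,\ \lambda_i\geqslant 0\ \text{for all } i\}$. A point $x^*\in\mathbb{R}^n$ is Pareto critical for $F$ if $\mathrm{range}(JF(x^* ))\cap(-\mathbb{R}^m_{++})=\emptyset$, i.e. there is no $d\in\mathbb{R}^n$ with $\nabla F_i(x^* )^{\mathrm T}d<0$ for all $i=1,\dots,m$. For a point $x$ and a symmetric positive definite matrix $B(x)$, $(t(x),d(x))\in\mathbb{R}\times\mathbb{R}^n$ denotes the unique solution of the quadratic program: minimize $t+\tfrac12 d^{\mathrm T}B(x)d$ subject to $\nabla F_i(x)^{\mathrm T}d\leqslant t$ for $i=1,\dots,m$. (At a Pareto critical point $x$ one has $d(x)=0$, $t(x)=0$ whatever the positive definite matrix $B(x)$ is.) A finite family of vectors $\{v_i\}_{i\in A}$ is affinely independent if $\{v_i-v_{i_0}: i\in A\setminus\{i_0\}\}$ is linearly independent for any fixed $i_0\in A$. GVMM: fixed parameters $\sigma,\gamma\in(0,1)$. Given the current iterate $x_k$ and a symmetric positive definite matrix $B_k\in\mathbb{R}^{n\times n}$ (the rule by which the matrices $B_k$ are updated is arbitrary), choose $$\lambda^k\in\arg\min_{\lambda\in\Delta_m}\tfrac12\Big(\sum_{i=1}^m\lambda_i\nabla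 F_i(x_k)\Big)^{\mathrm T}B_k^{-1}\Big(\sum_{i=1}^m\lambda_i\nabla F_i(x_k)\Big),\qquad d_k=-B_k^{-1}\sum_{i=1}^m\lambda_i^k\nabla F_i(x_k).$$ Let $\alpha_k$ be the first element of $1,\gamma,\gamma^2,\dots$ such that $F(x_k+\alpha_kd_k)-F(x_k)\leqslant\sigma\alpha_kJF(x_k)d_k$ componentwise (Armijo line search), and set $x_{k+1}=x_k+\alpha_kd_k$. (The algorithm stops only if $\tfrac12 d_k^{\mathrm T}B_kd_k$ is at most a given tolerance; it is assumed that it does not stop.) *)

(* Defs.v *)
From HB Require Import structures.
From mathcomp Require Import all_boot all_order all_algebra.
From mathcomp Require Import all_classical all_reals all_analysis.
Set Implicit Arguments.
Unset Strict Implicit.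
Unset Printing Implicit Defensive.
Import Order.TTheory GRing.Theory Num.Theory.
Import numFieldNormedType.Exports.

Local Open Scope classical_set_scope.
Local Open Scope ring_scope.

(* Vectors are rows: a point of R^n is an 'rV[R]_n, the textbook B v is
   v *m B^T (v *m B for symmetric B), and 'J F x is the n x m transpose of the
   textbook Jacobian JF(x), so that JF(x) d is d *m 'J F x. *)

Definition dot (R : realType) (n : nat) (u v : 'rV[R]_n) : R :=
  (u *m v^T) 0 0.

Definition qform (R : realType) (n : nat) (A : 'M[R]_n) (d : 'rV[R]_n) : R :=
  (d *m A *m d^T) 0 0.

Definition psdmx (R : realType) (n : nat) (A : 'M[R]_n) : Prop :=
  A^T = A /\ forall d : 'rV[R]_n, 0 <= qform A d.

Definition pdmx (R : realType) (n : nat) (A : 'M[R]_n) : Prop :=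
  A^T = A /\ forall d : 'rV[R]_n, d != 0 -> 0 < qform A d.

(* A <= B in the positive semidefinite order *)
Definition lemx (R : realType) (n : nat) (A B : 'M[R]_n) : Prop :=
  psdmx (B - A).

Definition levec (R : realType) (m : nat) (u v : 'rV[R]_m) : Prop :=
  forall i : 'I_m, u 0 i <= v 0 i.

Definition simplex (R : realType) (m : nat) : set 'rV[R]_m :=
  [set l | \sum_(i < m) l 0 i = 1 /\ forall i, 0 <= l 0 i].
Arguments simplex : clear implicits.

Definition gradient (R : realType) (n m : nat) (F : 'rV[R]_n -> 'rV[R]_m)
    (i : 'I_m) (x : 'rV[R]_n) : 'rV[R]_n :=
  (col i ('J F x))^T.

Definition hessian (R : realType) (n m : nat) (F : 'rV[R]_n -> 'rV[R]_m)
    (i : 'I_m) (x : 'rV[R]_n) : 'M[R]_n :=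
  'J (gradient F i) x.

(* 'J is total, hence the explicit differentiability clauses. *)
Definition twice_continuously_differentiable (R : realType) (n m : nat)
    (F : 'rV[R]_n -> 'rV[R]_m) : Prop :=
  (forall x, differentiable F x) /\
  forall i : 'I_m,
    (forall x, differentiable (gradient F i) x) /\ continuous (hessian F i).

Definition comb_gradient (R : realType) (n m : nat)
    (F : 'rV[R]_n -> 'rV[R]_m) (l : 'rV[R]_m) (x : 'rV[R]_n) : 'rV[R]_n :=
  \sum_(i < m) l 0 i *: gradient F i x.

Definition comb_hessian (R : realType) (n m : nat)
    (F : 'rV[R]_n -> 'rV[R]_m) (l : 'rV[R]_m) (x : 'rV[R]_n) : 'M[R]_n :=
  \sum_(i < m) l 0 i *: hessian F i x.

Definition pareto_critical (R : realType) (n m : nat)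
    (F : 'rV[R]_n -> 'rV[R]_m) (x : 'rV[R]_n) : Prop :=
  range (fun d : 'rV[R]_n => d *m 'J F x)
    `&` [set v : 'rV[R]_m | forall i, v 0 i < 0] = set0.

Definition qp_feasible (R : realType) (n m : nat)
    (F : 'rV[R]_n -> 'rV[R]_m) (x : 'rV[R]_n) (t : R) (d : 'rV[R]_n) : Prop :=
  forall i : 'I_m, dot (gradient F i x) d <= t.

Definition qp_objective (R : realType) (n : nat) (B : 'M[R]_n) (t : R)
    (d : 'rV[R]_n) : R :=
  t + 2^-1 * qform B d.

Definition qp_solution (R : realType) (n m : nat)
    (F : 'rV[R]_n -> 'rV[R]_m) (x : 'rV[R]_n) (B : 'M[R]_n)
    (t : R) (d : 'rV[R]_n) : Prop :=
  qp_feasible F x t d /\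
  forall (t' : R) (d' : 'rV[R]_n),
    qp_feasible F x t' d' -> qp_objective B t d <= qp_objective B t' d'.

Definition active_set (R : realType) (n m : nat)
    (F : 'rV[R]_n -> 'rV[R]_m) (x : 'rV[R]_n) (t : R) (d : 'rV[R]_n) :
    {set 'I_m} :=
  [set i | dot (gradient F i x) d == t].

Definition affinely_independent (R : realType) (n m : nat)
    (A : {set 'I_m}) (v : 'I_m -> 'rV[R]_n) : Prop :=
  forall i0, i0 \in A -> free [seq v i - v i0 | i in A :\ i0].

Definition dual_objective (R : realType) (n m : nat)
    (F : 'rV[R]_n -> 'rV[R]_m) (x : 'rV[R]_n) (B : 'M[R]_n)
    (l : 'rV[R]_m) : R :=
  2^-1 * qform (invmx B) (comb_gradient F l x).

Definition dual_solution (R : realType) (n m : nat)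
    (F : 'rV[R]_n -> 'rV[R]_m) (x : 'rV[R]_n) (B : 'M[R]_n)
    (l : 'rV[R]_m) : Prop :=
  simplex R m l /\
  forall l', simplex R m l' -> dual_objective F x B l <= dual_objective F x B l'.

Definition gvmm_direction (R : realType) (n m : nat)
    (F : 'rV[R]_n -> 'rV[R]_m) (x : 'rV[R]_n) (B : 'M[R]_n)
    (l : 'rV[R]_m) : 'rV[R]_n :=
  - (comb_gradient F l x *m invmx B).

Definition armijo (R : realType) (n m : nat)
    (F : 'rV[R]_n -> 'rV[R]_m) (sigma : R) (x d : 'rV[R]_n) (alpha : R) : Prop :=
  levec (F (x + alpha *: d) - F x) ((sigma * alpha) *: (d *m 'J F x)).

Definition armijo_step (R : realType) (n m : nat)
    (F : 'rV[R]_n -> 'rV[R]_m) (sigma gamma : R) (x d : 'rV[R]_n)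
    (alpha : R) : Prop :=
  exists p : nat, [/\ alpha = gamma ^+ p,
    armijo F sigma x d (gamma ^+ p) &
    forall q : nat, (q < p)%N -> ~ armijo F sigma x d (gamma ^+ q)].

(* Infinite run: the stopping test never fires, so no tolerance appears. *)
Definition gvmm (R : realType) (n m : nat)
    (F : 'rV[R]_n -> 'rV[R]_m) (sigma gamma : R) (x0 : 'rV[R]_n)
    (x : nat -> 'rV[R]_n) (B : nat -> 'M[R]_n) (lam : nat -> 'rV[R]_m) : Prop :=
  x 0%N = x0 /\
  forall k : nat, [/\ pdmx (B k), dual_solution F (x k) (B k) (lam k) &
    exists2 alpha : R,
      armijo_step F sigma gamma (x k)
        (gvmm_direction F (x k) (B k) (lam k)) alpha &
      x k.+1 = x k + alpha *: gvmm_direction F (x k) (B k) (lam k)].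

(* Main.v *)
(* Since [ls] is a multiplier at [xs], the dual optimal value at [x k] is at most
   its value at [ls], which is O(|sum_i ls_i grad F_i(x k)|^2); as soon as
   [x k --> xs] this forces sum_i (lam k)_i grad F_i(xs) --> 0, and compactness of
   the simplex together with uniqueness of the multiplier (affine independence;
   every index is active because the direction at a critical point is 0) gives
   [lam k --> ls].
   To see that [x k --> xs], note that every F_i (x k) decreases to F_i xs, so that
   all cluster points lie in the level set [F = F xs].  The second-order condition
   makes [xs] isolated in that level set, even though it only concerns directions
   orthogonal to all gradients: a nearby point of the level set yields, by Rolle,
   such a direction in the limit.  Finally the Armijo condition makes the steps
   tend to 0, and a sequence with vanishing steps cannot leave an isolated
   cluster point. *)

Require Import Defs.
From HB Require Import structures.
From mathcomp Require Import all_boot all_order all_algebra.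
From mathcomp Require Import all_classical all_reals all_analysis.
From mathcomp Require Import ring lra.
Set Implicit Arguments.
Unset Strict Implicit.
Unset Printing Implicit Defensive.
Import Order.TTheory GRing.Theory Num.Theory.
Import numFieldNormedType.Exports.

Local Open Scope classical_set_scope.
Local Open Scope ring_scope.

(** * Dot products, quadratic forms and bounds on the inverse matrix *)

Section Dot.
Context {R : realType} {n : nat}.
Implicit Types (u v w d g h : 'rV[R]_n) (A B : 'M[R]_n) (c : R).

Lemma dotE u v : dot u v = \sum_(j < n) u 0 j * v 0 j.
Proof. by rewrite /dot mxE; apply: eq_bigr => j _; rewrite mxE. Qed.

Lemma dotC u v : dot u v = dot v u.
Proof. by rewrite !dotE; apply: eq_bigr => j _; rewrite mulrC. Qed.

Lemma dotDl u v w : dot (u + v) w = dot u w + dot v w.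
Proof. by rewrite /dot mulmxDl mxE. Qed.

Lemma dotZl c u v : dot (c *: u) v = c * dot u v.
Proof. by rewrite /dot -scalemxAl mxE. Qed.

Lemma dotNl u v : dot (- u) v = - dot u v.
Proof. by rewrite -scaleN1r dotZl mulN1r. Qed.

Lemma dotDr u v w : dot u (v + w) = dot u v + dot u w.
Proof. by rewrite dotC dotDl !(dotC u). Qed.

Lemma dotZr c u v : dot u (c *: v) = c * dot u v.
Proof. by rewrite dotC dotZl dotC. Qed.

Lemma dotNr u v : dot u (- v) = - dot u v.
Proof. by rewrite dotC dotNl dotC. Qed.

Lemma dot_suml (I : finType) (f : I -> 'rV[R]_n) v :
  dot (\sum_i f i) v = \sum_i dot (f i) v.
Proof. by rewrite /dot mulmx_suml summxE. Qed.

Lemma dot0l v : dot 0 v = 0.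
Proof. by rewrite /dot mul0mx mxE. Qed.

Lemma dot0r v : dot v 0 = 0.
Proof. by rewrite dotC dot0l. Qed.

Lemma dot_ge0 u : 0 <= dot u u.
Proof. by rewrite dotE sumr_ge0 // => j _; rewrite -expr2 sqr_ge0. Qed.

(** The norm on rows is the sup norm, attained at some entry, whose square is one of the nonnegative
    terms of [dot u u]. *)
Lemma sqr_mxnorm_le_dot u : `|u| ^+ 2 <= dot u u.
Proof.
have [->|u0] := eqVneq u 0; first by rewrite normr0 expr0n /= dot_ge0.
have [[i j]] : exists ij, `|u| = `|u ij.1 ij.2|.
  by apply: mx_norm_neq0; rewrite -[mx_norm u]/`|u| normr_eq0.
rewrite /= (ord1 i) => ->; rewrite real_normK ?num_real// dotE (bigD1 j)//= -expr2.
by rewrite lerDl sumr_ge0// => k _; rewrite -expr2 sqr_ge0.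
Qed.

Lemma qformE A d : qform A d = dot (d *m A) d.
Proof. by []. Qed.

Lemma dot_mulmx_sym A u v : A^T = A -> dot (u *m A) v = dot (v *m A) u.
Proof.
move=> symA; rewrite /dot; have -> : u *m A *m v^T = (v *m A *m u^T)^T.
  by rewrite !trmx_mul trmxK symA mulmxA.
by rewrite mxE.
Qed.

Lemma qformDZ A u v c : A^T = A ->
  qform A (u + c *: v) = qform A u + 2 * c * dot (u *m A) v + c ^+ 2 * qform A v.
Proof.
move=> symA; rewrite !qformE mulmxDl -scalemxAl !dotDl !dotDr !dotZl !dotZr.
by rewrite (dot_mulmx_sym v u symA); ring.
Qed.

Lemma qform_scalar c d : qform c%:M d = c * dot d d.
Proof. by rewrite qformE mul_mx_scalar dotZl. Qed.

Lemma qformB A B d : qform (A - B) d = qform A d - qform B d.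
Proof. by rewrite !qformE mulmxBr dotDl dotNl. Qed.

Lemma lemx_qform A B d : lemx A B -> qform A d <= qform B d.
Proof. by move=> [_ /(_ d)]; rewrite qformB subr_ge0. Qed.

(** A nonzero row of the kernel of [B] would give the quadratic form the value 0. *)
Lemma pdmx_unit B : pdmx B -> B \in unitmx.
Proof.
move=> [_ pdB]; rewrite -row_free_unit -kermx_eq0; apply/eqP/row_matrixP => i.
rewrite row0; apply/eqP; apply: contraT => /pdB; rewrite qformE.
have /sub_kermxP -> := row_sub i (kermx B).
by rewrite dot0l ltxx.
Qed.

Lemma invmx_sym B : B^T = B -> (invmx B)^T = invmx B.
Proof. by rewrite trmx_inv => ->. Qed.

(** Passes from the dual form at [g] to the primal form at the direction [- g B^-1]. *)
Lemma qform_invmx B g : pdmx B ->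
  qform (invmx B) g = qform B (- (g *m invmx B)).
Proof.
move=> pdB; have symB := pdB.1.
rewrite !qformE mulNmx mulmxKV ?pdmx_unit// dotNl dotNr opprK.
by rewrite dotC.
Qed.

Lemma qform_invmx_ge0 B g : pdmx B -> 0 <= qform (invmx B) g.
Proof.
move=> pdB; rewrite qform_invmx//; set d := - _.
by have [->|/pdB.2/ltW//] := eqVneq d 0; rewrite qformE dot0r.
Qed.

(* Expand [0 <= a |e + h / a|^2] for [e = - h B^-1]. *)
Lemma qform_invmx_le (a : R) B h : 0 < a -> pdmx B -> lemx a%:M B ->
  qform (invmx B) h <= dot h h / a.
Proof.
move=> a0 pdB /lemx_qform aB; rewrite qform_invmx//; set e := - _.
have eB : e *m B = - h by rewrite /e mulNmx mulmxKV// pdmx_unit.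
have := aB e; rewrite qform_scalar qformE eB dotNl => ae.
have := dot_ge0 (h + a *: e).
rewrite !(dotDl, dotDr, dotZl, dotZr) (dotC e h) ler_pdivlMr//.
nra.
Qed.

(* Expand [0 <= qform B (g + b d)] for [d = - g B^-1]. *)
Lemma dot_le_qform_invmx (b : R) B g : 0 < b -> pdmx B -> lemx B b%:M ->
  dot g g <= b * qform (invmx B) g.
Proof.
move=> b0 pdB /lemx_qform Bb; rewrite qform_invmx//; set d := - _.
have dB : d *m B = - g by rewrite /d mulNmx mulmxKV// pdmx_unit.
have : 0 <= qform B (g + b *: d).
  have [->|/pdB.2/ltW//] := eqVneq (g + b *: d) 0.
  by rewrite qformE dot0r.
rewrite qformDZ ?pdB.1// (dot_mulmx_sym _ _ pdB.1) dB dotNl.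
have := Bb g; rewrite qform_scalar.
nra.
Qed.

End Dot.

(** * Optimality in the dual and primal quadratic programs *)

Lemma comb_gradientDZ (R : realType) (n m : nat) (F : 'rV[R]_n -> 'rV[R]_m)
    (l u : 'rV[R]_m) (c : R) (x : 'rV[R]_n) :
  comb_gradient F (l + c *: u) x = comb_gradient F l x + c *: comb_gradient F u x.
Proof.
rewrite /comb_gradient scaler_sumr -big_split /=; apply: eq_bigr => i _.
by rewrite !mxE scalerDl scalerA.
Qed.

Lemma comb_gradient_delta (R : realType) (n m : nat) (F : 'rV[R]_n -> 'rV[R]_m)
    (i : 'I_m) (x : 'rV[R]_n) :
  comb_gradient F (delta_mx 0 i) x = gradient F i x.
Proof.
rewrite /comb_gradient (bigD1 i)//= big1 ?addr0 => [|j /negPf ji].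
  by rewrite mxE !eqxx scale1r.
by rewrite mxE ji andbF scale0r.
Qed.

Lemma simplex_toward_vertex (R : realType) (m : nat) (l : 'rV[R]_m) (i : 'I_m)
    (s : R) : simplex R m l -> 0 <= s <= 1 ->
  simplex R m (l + s *: (delta_mx 0 i - l)).
Proof.
move=> [l1 l0] /andP[s0 s1]; split=> [|j].
  under eq_bigr do rewrite !mxE mulrBr addrCA.
  rewrite big_split sumrB /= l1 -!mulr_sumr l1.
  rewrite (bigD1 i)//= big1 => [|j /negPf->//].
  by rewrite eqxx addr0 !mulr1 addrC subrK.
rewrite !mxE; have := l0 j; case: (_ && _) => /= lj; nra.
Qed.

(* First-order optimality of [l] along the segment from [l] to the i-th vertex
   of the simplex. *)
Lemma dot_gradient_direction_le (R : realType) (n m : nat)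
    (F : 'rV[R]_n -> 'rV[R]_m) (x : 'rV[R]_n) (B : 'M[R]_n) (l : 'rV[R]_m)
    (i : 'I_m) : pdmx B -> dual_solution F x B l ->
  let d := gvmm_direction F x B l in dot (gradient F i x) d <= - qform B d.
Proof.
move=> pdB [lsimp lmin] /=; rewrite /gvmm_direction -qform_invmx//.
set g := comb_gradient F l x; set P := invmx B.
have symP : P^T = P by apply: invmx_sym; exact: pdB.1.
set h := gradient F i x - g.
suff : 0 <= dot (g *m P) h.
  by rewrite /h qformE dotDr !dotNr (dotC (gradient _ _ _)) subr_ge0 lerN2.
set c := dot _ _; have q0 : 0 <= qform P h by exact: qform_invmx_ge0.
(* Optimality of [l] says that the dual objective, a quadratic polynomial in [s], does not decrease
   from its value at [s = 0]. *)
have key s : 0 <= s <= 1 -> 0 <= 2 * s * c + s ^+ 2 * qform P h.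
  move=> s01; have := lmin _ (simplex_toward_vertex i lsimp s01).
  rewrite /dual_objective comb_gradientDZ -scaleN1r addrC comb_gradientDZ.
  rewrite addrC comb_gradient_delta ler_pM2l ?invr_gt0// scaleN1r.
  rewrite [comb_gradient F l x + _]addrC [_ + comb_gradient F l x]addrC.
  rewrite -/g -/P -/h qformDZ// -/c; lra.
rewrite leNgt; apply/negP => c0.
have cq : 0 < qform P h - c by lra.
(* If [c < 0], this [s] lies in [(0, 1]] and turns the expression in [key] into [s * c * (1 + s)],
   which is negative. *)
have := key (- c / (qform P h - c)).
have -> : 0 <= - c / (qform P h - c) <= 1.
  by rewrite ler_pdivlMr// ler_pdivrMr// mul0r mul1r; lra.
move=> /(_ isT); set s := _ / _; have sE : s * (qform P h - c) = - c.
  by rewrite /s mulfVK// gt_eqF.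
have s0 : 0 < s by rewrite divr_gt0 ?oppr_gt0.
nra.
Qed.

(** Since the gradients average to 0 under [l], [t] is the [l]-average of the slacks
    [t - dot (gradient F i x) d], hence nonnegative. Comparison with the feasible pair [(0, 0)] then
    leaves no room for a nonzero [d] or a positive [t]. *)
Lemma qp_solution_critical (R : realType) (n m : nat) (F : 'rV[R]_n -> 'rV[R]_m)
    (x : 'rV[R]_n) (B : 'M[R]_n) (l : 'rV[R]_m) (t : R) (d : 'rV[R]_n) :
  simplex R m l -> comb_gradient F l x = 0 -> pdmx B -> qp_solution F x B t d ->
  t = 0 /\ d = 0.
Proof.
move=> [l1 l0] lx [_ pdB] [feas opt].
have t0 : 0 <= t.
  have -> : t = \sum_i l 0 i * (t - dot (gradient F i x) d).
    under eq_bigr do rewrite mulrBr -dotZl.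
    by rewrite sumrB -mulr_suml l1 mul1r -dot_suml -/(comb_gradient F l x) lx
               dot0l subr0.
  by apply: sumr_ge0 => i _; rewrite mulr_ge0// subr_ge0.
have : qp_objective B t d <= qp_objective B 0 0.
  by apply: opt => i; rewrite dot0r.
rewrite /qp_objective [qform B 0]qformE dot0r mulr0 addr0.
have [->|dn0] := eqVneq d 0; last first.
  by move=> ?; exfalso; have := pdB _ dn0; lra.
rewrite qformE dot0r => t_le0; split=> //; apply/eqP.
by rewrite eq_le t0 andbT; move: t_le0; rewrite mulr0 addr0.
Qed.

(** The differences [mu] of the weights sum to 0, so their combination of the [v i] is also one of
    the [v i - v i0]. Freeness kills every [mu j] with [j != i0], and the zero sum kills [mu i0]. *)
Lemma affinely_independent_unique (R : realType) (n m : nat)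
    (v : 'I_m -> 'rV[R]_n) (l l' : 'rV[R]_m) :
  affinely_independent [set: 'I_m]%SET v ->
  \sum_i l 0 i = \sum_i l' 0 i ->
  \sum_i l 0 i *: v i = \sum_i l' 0 i *: v i -> l = l'.
Proof.
move=> indep sum_eq comb_eq.
pose mu i := l 0 i - l' 0 i.
have mu_sum : \sum_i mu i = 0 by rewrite sumrB sum_eq subrr.
have mu_comb : \sum_i mu i *: v i = 0.
  by under eq_bigr do rewrite scalerBl; rewrite sumrB comb_eq subrr.
suff mu0 i : mu i = 0 by apply/rowP => i; apply/eqP; rewrite -subr_eq0; exact/eqP/mu0.
have off i0 j : j != i0 -> mu j = 0.
  move=> ji0; have := indep i0 (finset.in_setT i0).
  set s := (X in free X) => /(@freeP _ _ _ (in_tuple s)) fr.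
  pose A := ([set: 'I_m] :\ i0)%SET.
  have sz : size s = #|A| by rewrite size_image.
  have comb0 : \sum_(i in A) mu i *: (v i - v i0) = 0.
    transitivity (\sum_i mu i *: (v i - v i0)).
      rewrite [RHS](bigD1 i0)//= subrr scaler0 add0r.
      by apply: eq_bigl => p; rewrite !inE andbT.
    under eq_bigr do rewrite scalerBr.
    by rewrite sumrB mu_comb -scaler_suml mu_sum scale0r subrr.
  have jA : j \in A by rewrite !inE ji0.
  (* [free] speaks of positions in the list [s], so the coefficients are transported along the
     enumeration of [A]. *)
  pose k (a : 'I_(size s)) := mu (enum_val (cast_ord sz a)).
  have /fr/(_ (cast_ord (esym sz) (enum_rank_in jA j))) :
      \sum_(a < size s) k a *: (in_tuple s)`_a = 0.
    rewrite -[RHS]comb0 [RHS]big_enum_val [RHS](reindex (cast_ord sz)) /=.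
      apply: eq_bigr => a _; congr (_ *: _).
      rewrite /s (nth_map (enum_val (cast_ord sz a))).
        by rewrite -(enum_val_nth _ (cast_ord sz a)).
      by rewrite -cardE -sz ltn_ord.
    by exists (cast_ord (esym sz)) => ? _; rewrite ?cast_ordK ?cast_ordKV.
  by rewrite /k cast_ordKV enum_rankK_in.
move: mu_sum; rewrite (bigD1 i)//= big1 ?addr0// => j; exact: off.
Qed.

(** * Derivatives along a segment and Rolle's theorem *)

Lemma rolle_derive (R : realType) (f f' : R -> R) (a b : R) : a < b ->
  (forall s : R, is_derive s 1 f (f' s)) -> f a = f b ->
  exists2 c, a < c < b & f' c = 0.
Proof.
move=> ab df fab.
have drv s : derivable f s 1 by have [] := df s.
have fc : {within `[a, b], continuous f}.
  apply: continuous_subspaceT => s; apply: differentiable_continuous.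
  exact/derivable1_diffP.
have [c cab dc] := Rolle ab (fun s _ => drv s) fc fab.
exists c; first by move: cab; rewrite in_itv.
by have [_ <-] := df c; have [_ ->] := dc.
Qed.

Lemma is_derive_line_coord (R : realType) (n p : nat) (G : 'rV[R]_n -> 'rV[R]_p)
    (x h : 'rV[R]_n) (j : 'I_p) (s : R) : differentiable G (x + s *: h) ->
  is_derive s 1 (fun s => G (x + s *: h) 0 j) ((h *m 'J G (x + s *: h)) 0 j).
Proof.
move=> dG.
have dcoord (M : 'rV[R]_p) :
    is_diff M (fun N : 'rV[R]_p => N 0 j : R) (fun N : 'rV[R]_p => N 0 j : R).
  (* The coordinate map is repackaged as a linear map, which is its own differential. *)
  have @f : {linear 'rV[R]_p -> R}.
    by exists (fun N : 'rV[R]_p => N 0 j); do 2![eexists]; do ?[constructor];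
       rewrite ?mxE// => ? *; rewrite ?mxE//; move=> ?; rewrite !mxE.
  apply: DiffDef; first exact: differentiable_coord.
  rewrite (_ : (fun _ => _) = f) // diff_lin//; exact: coord_continuous.
have dline : is_diff s (fun s : R => x + s *: h) (fun s : R => s *: h).
  have := is_diffD (is_diff_cst x s) (is_diff_scalel s h).
  by rewrite add0r.
have dGl : is_diff (x + s *: h) G ('d G (x + s *: h)) by exact: DiffDef.
have dall := is_diff_comp (is_diff_comp dline dGl) (dcoord _).
apply: DeriveDef.
  by apply/derivable1_diffP; have [] := dall.
rewrite deriveE; last by have [] := dall.
by have [_ ->] := dall; rewrite /= scale1r /jacobian mul_rV_lin1.
Qed.

Lemma dot_gradient_jacobian (R : realType) (n m : nat)
    (F : 'rV[R]_n -> 'rV[R]_m) (i : 'I_m) (x h : 'rV[R]_n) :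
  dot (gradient F i x) h = (h *m 'J F x) 0 i.
Proof.
by rewrite dotC dotE mxE; apply: eq_bigr => k _; congr (_ * _); rewrite !mxE.
Qed.

Section Segment.
Context {R : realType} {n m : nat} (F : 'rV[R]_n -> 'rV[R]_m).
Context (F_C2 : twice_continuously_differentiable F).
Implicit Types (x h : 'rV[R]_n) (s : R).

Lemma is_derive_line_component x h (i : 'I_m) s :
  is_derive s 1 (fun s => F (x + s *: h) 0 i) (dot (gradient F i (x + s *: h)) h).
Proof.
by rewrite dot_gradient_jacobian; exact/is_derive_line_coord/F_C2.1.
Qed.

Lemma is_derive_line_gradient x h (i : 'I_m) s :
  is_derive s 1 (fun s => dot (gradient F i (x + s *: h)) h)
    (qform (hessian F i (x + s *: h)) h).
Proof.
rewrite qformE dotE.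
have -> : (fun s => dot (gradient F i (x + s *: h)) h) =
    \sum_(j < n) h 0 j \*: (fun s => gradient F i (x + s *: h) 0 j).
  rewrite fct_sumE; apply/funext => r; rewrite dotE; apply: eq_bigr => j _.
  by rewrite mulrC.
apply: is_derive_sum => j; rewrite mulrC.
by apply: is_deriveZ; apply/is_derive_line_coord/(F_C2.2 i).1.
Qed.

Lemma dot_comb_gradient (l : 'rV[R]_m) x h :
  dot (comb_gradient F l x) h = \sum_i l 0 i * dot (gradient F i x) h.
Proof. by rewrite dot_suml; apply: eq_bigr => i _; rewrite dotZl. Qed.

Lemma qform_comb_hessian (l : 'rV[R]_m) x h :
  qform (comb_hessian F l x) h = \sum_i l 0 i * qform (hessian F i x) h.
Proof.
rewrite qformE mulmx_sumr dot_suml; apply: eq_bigr => i _.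
by rewrite -scalemxAr dotZl.
Qed.

Lemma rolle_component x h (i : 'I_m) : F (x + h) = F x ->
  exists2 s, 0 < s < 1 & dot (gradient F i (x + s *: h)) h = 0.
Proof.
move=> Fxh; apply: rolle_derive (is_derive_line_component x h i) _; first exact: ltr01.
by rewrite scale0r addr0 scale1r Fxh.
Qed.

(* Rolle twice: the derivative of the Lagrangian along the segment vanishes at
   the endpoint [x], since [x] is critical, and at an interior point. *)
Lemma rolle_lagrangian (l : 'rV[R]_m) x h :
  comb_gradient F l x = 0 -> F (x + h) = F x ->
  exists2 s, 0 < s < 1 & qform (comb_hessian F l (x + s *: h)) h = 0.
Proof.
move=> crit Fxh.
(* The Lagrangian along the segment, followed by its first two derivatives. *)
pose f0 s := \sum_i l 0 i * F (x + s *: h) 0 i.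
pose f1 s := dot (comb_gradient F l (x + s *: h)) h.
pose f2 s := qform (comb_hessian F l (x + s *: h)) h.
have df0 s : is_derive s 1 f0 (f1 s).
  rewrite /f1 dot_comb_gradient.
  have -> : f0 = \sum_i l 0 i \*: (fun s => F (x + s *: h) 0 i).
    by rewrite fct_sumE.
  by apply: is_derive_sum => i; apply/is_deriveZ/is_derive_line_component.
have df1 s : is_derive s 1 f1 (f2 s).
  rewrite /f2 qform_comb_hessian.
  have -> : f1 = \sum_i l 0 i \*: (fun s => dot (gradient F i (x + s *: h)) h).
    by rewrite fct_sumE; apply/funext => r; rewrite /f1 dot_comb_gradient.
  by apply: is_derive_sum => i; apply/is_deriveZ/is_derive_line_gradient.
have [|s /andP[s0 s1] f1s] := rolle_derive ltr01 df0.
  by apply: eq_bigr => i _; rewrite scale0r addr0 scale1r Fxh.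
have [|r /andP[r0 rs] f2r] := rolle_derive s0 df1.
  by rewrite f1s /f1 scale0r addr0 crit dot0l.
by exists r; rewrite // r0 (lt_trans rs).
Qed.

End Segment.

(** * Cluster points and convergence of sequences *)

(** Each point of [K] has a neighbourhood that the sequence eventually avoids; the near-covering
    form of compactness yields one threshold for all of [K]. *)
Lemma compact_near_not_cluster (T : topologicalType) (K : set T) (u : nat -> T) :
  compact K -> (forall y, K y -> ~ cluster (u @ \oo) y) ->
  \forall k \near \oo, ~ K (u k).
Proof.
move=> /compact_near_coveringP cK ncl.
have : \forall k \near \oo, K `<=` (fun y => u k <> y).
  apply: cK => y Ky; apply: contrapT => nearN; apply: (ncl y Ky) => A C uA yC.
  apply: contrapT => AC0; apply: nearN; exists (C, u @^-1` A) => // -[z k] /= [Cz Auk].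
  by move=> ukz; apply: AC0; exists (u k); split=> //; rewrite ukz.
by apply: filterS => k Kk Kuk; exact: Kk Kuk erefl.
Qed.

Lemma cluster_comp (T U : topologicalType) (u : nat -> T) (f : T -> U) (y : T) :
  {for y, continuous f} -> cluster (u @ \oo) y -> cluster (f \o u @ \oo) (f y).
Proof.
move=> fy cl A C uA /fy fC.
by have [z [Az Cz]] := cl (f @^-1` A) _ uA fC; exists (f z).
Qed.

Lemma cluster_cvg_eq (T : topologicalType) (u : nat -> T) (y l : T) :
  hausdorff_space T -> cluster (u @ \oo) y -> u @ \oo --> l -> y = l.
Proof. by move=> hT cl ul; apply: hT => A C yA lC; rewrite setIC; apply: cl => //; exact: ul. Qed.

Lemma nonincreasing_cluster_cvg (R : realType) (u : nat -> R) (l : R) :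
  (forall k, u k.+1 <= u k) -> cluster (u @ \oo) l -> u @ \oo --> l.
Proof.
move=> /nonincreasing_seqP ui /cluster_eventuallyP cl.
have lu k : l <= u k.
  rewrite leNgt; apply/negP => ukl.
  (* Once below [l], the sequence stays at distance at least [l - u k] from it, so half that gap is
     a contradictory precision. *)
  have [p kp] := cl ((l - u k) / 2) k ltac:(lra).
  by have := ui _ _ kp; rewrite ler_norml; lra.
apply/cvgrPdist_le => e e0; have [p _ pe] := cl e 0%N e0.
exists p => // k /= pk; move: (ui _ _ pk) (lu k) pe.
by rewrite !ler_norml; lra.
Qed.

(** Serves for the shell around an isolated cluster point, for the unit sphere ([r = s = 1]) and for
    the part of a ball away from its centre. *)
Lemma compact_shell (R : realType) (n : nat) (c : 'rV[R]_n) (r s : R) :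
  compact [set y : 'rV[R]_n | r <= `|y - c| <= s].
Proof.
have cont : continuous (fun y : 'rV[R]_n => `|y - c|).
  by move=> y; apply: (cvg_norm (cvgB cvg_id (cvg_cst c))).
apply: bounded_closed_compact.
  exists (s + `|c|); split; first exact: num_real.
  move=> M sM y /= /andP[_ ys]; apply: le_trans (ltW sM).
  by rewrite -[y](subrK c) (le_trans (ler_normD _ _))// lerD2r.
rewrite (_ : mkset _ = (fun y => `|y - c|) @^-1` [set z : R | r <= z] `&`
                       (fun y => `|y - c|) @^-1` [set z : R | z <= s]).
  apply: closedI; apply: closed_comp => [? _|]; do ?exact: cont.
    exact: closed_ge.
  exact: closed_le.
by apply/seteqP; split=> y /= /andP.
Qed.

Lemma cvg_sqr_norm_le (R : realType) (V : normedModType R) (u : nat -> V)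
    (r : nat -> R) : (forall k, `|u k| ^+ 2 <= r k) -> r @ \oo --> (0 : R) ->
  u @ \oo --> (0 : V).
Proof.
move=> ur r0; apply/cvgr0Pnorm_lt => e e0.
have e20 : 0 < e ^+ 2 by rewrite exprn_gt0.
apply: filterS (cvgr_lt _ r0 _ e20) => k rk.
rewrite -(ltr_pXn2r (n := 2)) ?nnegrE//; last exact: ltW.
exact: le_lt_trans (ur k) rk.
Qed.

(* A trajectory with vanishing steps cannot cross the shell between radii [e/2]
   and [e] around an isolated cluster point. *)
Lemma cvg_isolated_cluster (R : realType) (n : nat) (x : nat -> 'rV[R]_n)
    (c : 'rV[R]_n) (r : R) : 0 < r ->
  (forall y, cluster (x @ \oo) y -> `|y - c| <= r -> y = c) ->
  cluster (x @ \oo) c -> (fun k => x k.+1 - x k) @ \oo --> (0 : 'rV[R]_n) ->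
  x @ \oo --> c.
Proof.
move=> r0 isol cl steps; apply/cvgrPdist_lt => e' e'0.
(* Capping the radius by [r] keeps the shell inside the ball where [c] is the only cluster point. *)
pose e := Num.min e' r; have e0 : 0 < e by rewrite lt_min e'0.
have e20 : 0 < e / 2 by rewrite divr_gt0.
have /compact_near_not_cluster off : compact [set y | e / 2 <= `|y - c| <= e].
  exact: compact_shell.
have {off} [|N1 _ off] := off x.
  move=> y /= /andP[ey ye] cly; have ec : y = c.
    by apply: isol => //; apply: le_trans ye _; rewrite ge_min lexx orbT.
  by move: ey; rewrite ec subrr normr0 leNgt e20.
have /cvgr0Pnorm_lt/(_ _ e20)[N2 _ small] := steps.
have [_ [[k0 /= ltk0 <-] xk0]] := cl [set z | exists2 k, (maxn N1 N2 <= k)%N & x k = z]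
  (ball c (e / 2)) ltac:(by exists (maxn N1 N2) => // k /= hk; exists k)
  (nbhsx_ballx _ _ e20).
move: xk0; rewrite mx_norm_ball /ball_ /= distrC => xk0.
(* From distance below [e / 2], a step shorter than [e / 2] ends at distance below [e]; as the shell
   is avoided, it ends below [e / 2] again. *)
have stay k : (k0 <= k)%N -> `|x k - c| < e / 2.
  elim: k => [|k IH].
    by rewrite leqn0 => /eqP k00; move: xk0; rewrite k00.
  rewrite leq_eqVlt => /predU1P[<-//|].
  rewrite ltnS => k0k; have xk := IH k0k.
  have kN : (maxn N1 N2 <= k)%N by exact: leq_trans k0k.
  have /= sk := small k (leq_trans (leq_maxr _ _) kN).
  have /= ok := off k.+1 (leq_trans (leq_trans (leq_maxl N1 N2) kN) (leqnSn k)).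
  have : `|x k.+1 - c| < e.
    rewrite -(subrKA (x k)) (splitr e) (le_lt_trans (ler_normD _ _))// ltrD//.
  by move=> /ltW xe; rewrite ltNge; apply/negP => ex; apply: ok; rewrite ex xe.
exists k0 => // k /= /stay; rewrite distrC => /lt_le_trans; apply.
by rewrite (le_trans (y := e)) ?ge_min ?lexx//; lra.
Qed.

(** * Limits of sums, dot products and quadratic forms *)

Lemma cvg_fsum (R : numFieldType) (V : normedModType R) (m : nat) (T : Type)
    (D : set_system T) {FD : Filter D} (f : 'I_m -> T -> V) (a : 'I_m -> V) :
  (forall i, f i t @[t --> D] --> a i) ->
  \sum_i f i t @[t --> D] --> \sum_i a i.
Proof. by move=> fa; apply: cvg_big => [|i _]; [exact: add_continuous|exact: fa]. Qed.

Lemma cvg_coord (R : realType) (p q : nat) (T : Type) (D : set_system T)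
    {FD : Filter D} (f : T -> 'M[R]_(p, q)) (A : 'M[R]_(p, q)) i j :
  f @ D --> A -> f t i j @[t --> D] --> A i j.
Proof.
by move=> fA; apply: (cvg_comp f (fun M : 'M[R]_(p, q) => M i j) fA); exact: coord_continuous.
Qed.

Lemma cvg_dot (R : realType) (n : nat) (T : Type) (D : set_system T)
    {FD : Filter D} (f g : T -> 'rV[R]_n) (u v : 'rV[R]_n) :
  f @ D --> u -> g @ D --> v -> dot (f t) (g t) @[t --> D] --> dot u v.
Proof.
move=> fu gv; rewrite (eq_cvg _ _ (fun t => dotE (f t) (g t))) dotE.
apply: cvg_fsum => j.
by apply: cvgM; exact: cvg_coord.
Qed.

Lemma cvg_qform (R : realType) (n : nat) (T : Type) (D : set_system T)
    {FD : Filter D} (A : T -> 'M[R]_n) (f : T -> 'rV[R]_n) (M : 'M[R]_n)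
    (u : 'rV[R]_n) :
  A @ D --> M -> f @ D --> u -> qform (A t) (f t) @[t --> D] --> qform M u.
Proof.
move=> AM fu; have qE B (v : 'rV[R]_n) :
    qform B v = \sum_j (\sum_k v 0 k * B k j) * v 0 j.
  by rewrite qformE dotE; apply: eq_bigr => j _; rewrite mxE.
rewrite (eq_cvg _ _ (fun t => qE (A t) (f t))) qE.
apply: cvg_fsum => j.
apply: cvgM; last exact: cvg_coord.
apply: cvg_fsum => k.
by apply: cvgM; exact: cvg_coord.
Qed.

(** * Isolation of a critical point in its level set *)

Section Isolated.
Context {R : realType} {n m : nat} (F : 'rV[R]_n -> 'rV[R]_m).
Context (F_C2 : twice_continuously_differentiable F).

Lemma continuous_gradient (i : 'I_m) : continuous (gradient F i).
Proof. by move=> x; apply/differentiable_continuous/(F_C2.2 i).1. Qed.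

Lemma continuous_component (i : 'I_m) : continuous (fun x => F x 0 i).
Proof.
move=> x; apply: (@continuous_comp _ _ _ F (fun v : 'rV[R]_m => v 0 i)).
  by apply: differentiable_continuous; exact: F_C2.1.
exact: coord_continuous.
Qed.

Lemma cvg_dot_gradient (i : 'I_m) (x u : 'rV[R]_n) :
  dot (gradient F i p.1) p.2 @[p --> (x, u)] --> dot (gradient F i x) u.
Proof.
have c1 : (p.1 : 'rV[R]_n) @[p --> (x, u)] --> x by exact: cvg_fst.
have c2 : (p.2 : 'rV[R]_n) @[p --> (x, u)] --> u by exact: cvg_snd.
exact: cvg_dot (continuous_cvg _ (@continuous_gradient i x) c1) c2.
Qed.

Lemma cvg_qform_hessian (l : 'rV[R]_m) (x u : 'rV[R]_n) :
  qform (comb_hessian F l p.1) p.2 @[p --> (x, u)] --> qform (comb_hessian F l x) u.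
Proof.
have c1 : (p.1 : 'rV[R]_n) @[p --> (x, u)] --> x by exact: cvg_fst.
have c2 : (p.2 : 'rV[R]_n) @[p --> (x, u)] --> u by exact: cvg_snd.
have c3 : comb_hessian F l p.1 @[p --> (x, u)] --> comb_hessian F l x.
  apply: cvg_fsum => i.
  exact: cvgZl_tmp (continuous_cvg _ ((F_C2.2 i).2 x) c1).
exact: cvg_qform c3 c2.
Qed.

(** Joint continuity lets the direction vary near [u] and the base point range over a whole small
    ball; this is the local statement that the near-covering form of compactness requires. *)
Lemma near_uniform_neq0 (f : 'rV[R]_n -> 'rV[R]_n -> R) (x u : 'rV[R]_n) :
  f p.1 p.2 @[p --> (x, u)] --> f x u -> f x u != 0 ->
  \forall v \near u & e \near 0^'+, forall z, `|z - x| <= e -> f z v != 0.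
Proof.
move=> fc fxu; have fxu' : 0 < `|f x u| by rewrite normr_gt0.
have : \forall p \near (x, u), f p.1 p.2 != 0.
  apply: filterS (cvgr_norm_gt _ fc _ fxu') => p.
  by rewrite normr_gt0.
move=> [[X U] /= [/nbhs_ballP[e /= e0 eX] uU] XU].
exists (U, [set t | t < e]); first by split => //=; exact: nbhs_right_lt.
move=> [v t] /= [Uv te] z zx; apply: (XU (z, v)); split => //=; apply: eX.
by rewrite mx_norm_ball /ball_ /= distrC (le_lt_trans zx).
Qed.

(* Rolle along the segment from [x] to a second point of the level set produces
   a unit vector violating the second-order condition, up to a perturbation of
   the base point that compactness of the sphere absorbs. *)
Lemma level_set_isolated (l : 'rV[R]_m) (x : 'rV[R]_n) :
  comb_gradient F l x = 0 ->
  (forall d : 'rV[R]_n, d != 0 -> (forall i, dot (gradient F i x) d = 0) ->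
    0 < qform (comb_hessian F l x) d) ->
  \forall e \near 0^'+, forall y, `|y - x| <= e -> F y = F x -> y = x.
Proof.
move=> crit sosc.
(* [P e u] excludes [u] as the direction of a segment of length at most [e] from [x] to another
   point of the level set: Rolle would give a zero of each of these functions within distance [e] of
   [x]. *)
pose P e u := (exists i, forall z, `|z - x| <= e -> dot (gradient F i z) u != 0) \/
  (forall z, `|z - x| <= e -> qform (comb_hessian F l z) u != 0).
have /compact_near_coveringP/(_ R (0^'+) P _) : compact [set u : 'rV[R]_n | 1 <= `|u - 0| <= 1].
  exact: compact_shell.
have cover u : 1 <= `|u - 0| <= 1 -> \forall v \near u & e \near 0^'+, P e v.
  rewrite subr0 -eq_le => /eqP u1.
  have u0 : u != 0 by rewrite -normr_eq0 -u1 oner_neq0.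
  have [grad0|/existsNP[i /eqP gradi]] := pselect (forall i, dot (gradient F i x) u = 0).
    have := @near_uniform_neq0 (fun z => qform (comb_hessian F l z)) x u
      (@cvg_qform_hessian l x u) (lt0r_neq0 (sosc _ u0 grad0)).
    by apply: filterS => p Hp; right.
  have := @near_uniform_neq0 (fun z => dot (gradient F i z)) x u
    (@cvg_dot_gradient i x u) gradi.
  by apply: filterS => p Hp; left; exists i.
move=> /(_ cover); apply: filterS => e He y yx Fyx.
apply/eqP; rewrite -subr_eq0; apply: contraT => h0; set h := y - x in yx h0.
have yE : y = x + h by rewrite addrC subrK.
have Fxh : F (x + h) = F x by rewrite -yE.
have hn : 0 < `|h| by rewrite normr_gt0.
have close s : 0 < s < 1 -> `|x + s *: h - x| <= e.
  move=> /andP[s0 s1]; rewrite addrC addKr normrZ gtr0_norm//.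
  by rewrite (le_trans _ yx)// ler_piMl// ltW.
(* [P] is known on unit vectors only; by homogeneity the zeros found for [h] are also zeros for its
   normalization. *)
have [[i Hi]|H] : P e (`|h|^-1 *: h).
  by apply: He; rewrite /= subr0 normrZ normfV normr_id mulVf ?gt_eqF// lexx.
  have [s /close sx ds] := rolle_component F_C2 i Fxh.
  by have := Hi _ sx; rewrite dotZr ds mulr0 eqxx.
have [s /close sx ds] := rolle_lagrangian F_C2 crit Fxh.
have := H _ sx; rewrite qformE -scalemxAl dotZl dotZr.
by move: ds; rewrite qformE => ->; rewrite !mulr0 eqxx.
Qed.

End Isolated.

(** * Decrease of the objectives and vanishing steps *)

Section Descent.
Context {R : realType} {n m : nat} (F : 'rV[R]_n -> 'rV[R]_m).
Context (sigma gamma a : R) (x0 : 'rV[R]_n) (x : nat -> 'rV[R]_n).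
Context (B : nat -> 'M[R]_n) (lam : nat -> 'rV[R]_m).
Context (sigma0 : 0 < sigma) (gamma01 : 0 < gamma < 1) (a0 : 0 < a).
Context (run : gvmm F sigma gamma x0 x B lam).
Context (aB : forall k, lemx a%:M (B k)).

(** With [d] the direction and [al] the step size, the Armijo condition and dual optimality give a
    decrease of at least [sigma * al * qform (B k) d], hence of at least [sigma * al * a * |d|^2];
    and [al^2 <= al] since [al <= 1]. *)
Lemma gvmm_step_sqr_le (i : 'I_m) (k : nat) :
  `|x k.+1 - x k| ^+ 2 <= (sigma * a)^-1 * (F (x k) 0 i - F (x k.+1) 0 i).
Proof.
have [_ /(_ k)[pdB lamk [_ [p [-> arm _]] xS]]] := run.
have entryB (u v : 'rV[R]_m) : (u - v) 0 i = u 0 i - v 0 i by rewrite !mxE.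
have entryZ c (u : 'rV[R]_m) : (c *: u) 0 i = c * u 0 i by rewrite mxE.
have := arm i; rewrite -xS; move: lamk xS; set d := gvmm_direction _ _ _ _.
rewrite entryB entryZ -dot_gradient_jacobian =>
   /(dot_gradient_direction_le i pdB) /= gd xS Fd.
have [g0 g1] := andP gamma01; set al := gamma ^+ p in xS Fd.
have al0 : 0 < al by exact: exprn_gt0.
have al1 : al <= 1 by apply: exprn_ile1; exact: ltW.
have -> : x k.+1 - x k = al *: d by rewrite xS addrC addKr.
rewrite mulrC ler_pdivlMr ?mulr_gt0//.
have ad : a * dot d d <= qform (B k) d by rewrite -qform_scalar lemx_qform.
have dd : `|d| ^+ 2 <= dot d d by exact: sqr_mxnorm_le_dot.
rewrite normrZ gtr0_norm// exprMn.
have F_le : sigma * al * (a * `|d| ^+ 2) <= F (x k) 0 i - F (x k.+1) 0 i.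
  have : sigma * al * (a * `|d| ^+ 2) <= sigma * al * qform (B k) d.
    apply: ler_wpM2l; first by rewrite mulr_ge0// ltW.
    by apply: le_trans ad; rewrite ler_pM2l.
  have : sigma * al * dot (gradient F i (x k)) d <= sigma * al * - qform (B k) d.
    by apply: ler_wpM2l gd; rewrite mulr_ge0// ltW.
  by rewrite mulrN; lra.
apply: le_trans F_le; rewrite [leLHS](_ : _ = sigma * al * (a * `|d| ^+ 2) * al); last ring.
by rewrite ler_piMr// !mulr_ge0// ?sqr_ge0// ltW.
Qed.

Lemma gvmm_nonincreasing (i : 'I_m) (k : nat) : F (x k.+1) 0 i <= F (x k) 0 i.
Proof.
rewrite -subr_ge0; have := le_trans (sqr_ge0 _) (gvmm_step_sqr_le i k).
by rewrite pmulr_rge0// invr_gt0 mulr_gt0.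
Qed.

Lemma gvmm_steps_cvg0 (i : 'I_m) (l : R) :
  F (x k) 0 i @[k --> \oo] --> l -> x k.+1 - x k @[k --> \oo] --> (0 : 'rV[R]_n).
Proof.
move=> Fl; apply: cvg_sqr_norm_le (gvmm_step_sqr_le i) _.
rewrite -[X in _ --> X](mulr0 (sigma * a)^-1) -(subrr l).
by apply: cvgZl_tmp; apply: cvgB => //; rewrite (cvg_shiftS (fun k => F (x k) 0 i)).
Qed.

End Descent.

(** * Convergence of the multipliers *)

(** The bounds on [B] compare its inverse form with the dot product from both sides, and optimality
    of [l] links the two estimates. *)
Lemma dual_solution_dot_le (R : realType) (n m : nat) (F : 'rV[R]_n -> 'rV[R]_m)
    (a b : R) (x : 'rV[R]_n) (B : 'M[R]_n) (l l' : 'rV[R]_m) :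
  0 < a -> 0 < b -> pdmx B -> lemx a%:M B -> lemx B b%:M ->
  dual_solution F x B l -> simplex R m l' ->
  dot (comb_gradient F l x) (comb_gradient F l x) <=
    b / a * dot (comb_gradient F l' x) (comb_gradient F l' x).
Proof.
move=> a0 b0 pdB aB Bb [_ lmin] /lmin; rewrite /dual_objective ler_pM2l ?invr_gt0// => ll'.
apply: le_trans (dot_le_qform_invmx _ b0 pdB Bb) _.
rewrite -mulrA [a^-1 * _]mulrC ler_pM2l//; apply: le_trans ll' _.
exact: qform_invmx_le.
Qed.

Lemma simplex_le1 (R : realType) (m : nat) (l : 'rV[R]_m) (i : 'I_m) :
  simplex R m l -> 0 <= l 0 i <= 1.
Proof.
move=> [<- l0]; rewrite l0 (bigD1 i)//= lerDl sumr_ge0// => j _; exact: l0.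
Qed.

(** Places the simplex in a unit ball around any of its points, so that compactness of a shell can
    stand in for compactness of the simplex. *)
Lemma simplex_dist_le1 (R : realType) (m : nat) (l l' : 'rV[R]_m) :
  simplex R m l -> simplex R m l' -> `|l - l'| <= 1.
Proof.
move=> sl sl'; have [->|ll'] := eqVneq (l - l') 0; first by rewrite normr0.
have [[i j] ->] : exists ij, `|l - l'| = `|(l - l') ij.1 ij.2|.
  by apply: mx_norm_neq0; rewrite -[mx_norm _]/`|l - l'| normr_eq0.
rewrite /= (ord1 i) !mxE ler_norml.
by have := simplex_le1 j sl; have := simplex_le1 j sl'; lra.
Qed.

(** Weights in [[0, 1]] make the change of base point cost at most the sum of the gradient
    variations, whatever [lam k] is. *)
Lemma comb_gradient_lam_cvg0 (R : realType) (n m : nat) (F : 'rV[R]_n -> 'rV[R]_m)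
    (lam : nat -> 'rV[R]_m) (x : nat -> 'rV[R]_n) (c : 'rV[R]_n) :
  (forall i, {for c, continuous (gradient F i)}) ->
  (forall k, simplex R m (lam k)) -> x @ \oo --> c ->
  comb_gradient F (lam k) (x k) @[k --> \oo] --> (0 : 'rV[R]_n) ->
  comb_gradient F (lam k) c @[k --> \oo] --> (0 : 'rV[R]_n).
Proof.
move=> gc sl xc g0.
pose r k := \sum_i `|gradient F i c - gradient F i (x k)|.
have r0 : r @ \oo --> (0 : R).
  have -> : (0 : R) = \sum_(i < m) `|gradient F i c - gradient F i c|.
    by rewrite big1 // => i _; rewrite subrr normr0.
  apply: cvg_fsum => i.
  exact: cvg_norm (cvgB (cvg_cst _) (continuous_cvg _ (gc i) xc)).
rewrite -[X in _ --> X](addr0 0).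
have -> : (fun k => comb_gradient F (lam k) c) = (fun k => comb_gradient F (lam k) (x k) +
    (comb_gradient F (lam k) c - comb_gradient F (lam k) (x k))).
  by apply/funext => k; rewrite addrC subrK.
apply: cvgD => //; apply/cvgr0Pnorm_lt => e e0.
apply: filterS (cvgr_lt _ r0 _ e0) => k; apply: le_lt_trans.
rewrite /comb_gradient -sumrB; apply: le_trans (ler_norm_sum _ _ _) _.
apply: ler_sum => i _; rewrite -scalerBr normrZ ler_piMl//.
by have /andP[l0 l1] := simplex_le1 i (sl k); rewrite ger0_norm.
Qed.

Theorem theorem3 (R : realType) (n m : nat) (F : 'rV[R]_n -> 'rV[R]_m)
    (F_C2 : twice_continuously_differentiable F)
    (sigma gamma : R) (sigma01 : 0 < sigma < 1) (gamma01 : 0 < gamma < 1)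
    (x0 : 'rV[R]_n) (x : nat -> 'rV[R]_n) (B : nat -> 'M[R]_n)
    (lam : nat -> 'rV[R]_m)
    (run : gvmm F sigma gamma x0 x B lam)
    (noncritical : forall k, ~ pareto_critical F (x k))
    (bounded_B : exists a b : R, [/\ 0 < a, 0 < b &
       forall k, lemx a%:M (B k) /\ lemx (B k) b%:M])
    (compact_levels : forall y0 : 'rV[R]_n,
       compact [set y | levec (F y) (F y0)])
    (xs : 'rV[R]_n) (ls : 'rV[R]_m)
    (xs_accumulation : cluster (x @ \oo) xs)
    (ls_simplex : simplex R m ls)
    (ls_multiplier : comb_gradient F ls xs = 0)
    (second_order : forall d : 'rV[R]_n, d != 0 ->
       (forall i : 'I_m, dot (gradient F i xs) d = 0) ->
       0 < qform (comb_hessian F ls xs) d)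
    (Bs : 'M[R]_n) (Bs_pd : pdmx Bs) (ts : R) (ds : 'rV[R]_n)
    (ts_ds_qp : qp_solution F xs Bs ts ds)
    (active_affine : affinely_independent (active_set F xs ts ds)
       (fun i => gradient F i xs)) :
  lam @ \oo --> ls.
Proof.
have [a [b [a0 b0 abB]]] := bounded_B.
have [sigma0 _] := andP sigma01.
have aB k : lemx a%:M (B k) by have [] := abB k.
have grad_cont i : continuous (gradient F i) by exact: continuous_gradient.
have lam_simplex k : simplex R m (lam k) by have [_ /(_ k)[_ []]] := run.
(* Weights summing to 1 force [m > 0]; one component is enough to control the steps. *)
have [i0 _|no_index] := pickP (xpredT : pred 'I_m); last first.
  have [ls1 _] := ls_simplex; move: ls1; rewrite big_pred0 => [/eqP|i].
    by rewrite eq_sym oner_eq0.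
  exact: no_index.
have F_cvg i : F (x k) 0 i @[k --> \oo] --> F xs 0 i.
  apply: nonincreasing_cluster_cvg => [k|].
    exact: (gvmm_nonincreasing sigma0 gamma01 a0 run aB).
  apply: (@cluster_comp _ _ x (fun y => F y 0 i)) => //.
  exact: continuous_component.
have x_cvg : x @ \oo --> xs.
  have [r r0 isol] : exists2 r, 0 < r & forall y, `|y - xs| <= r -> F y = F xs -> y = xs.
    near (0 : R)^'+ => r; exists r => //.
    by near: r; exact: (level_set_isolated F_C2 ls_multiplier second_order).
  apply: (cvg_isolated_cluster r0) => //; last first.
    exact: (gvmm_steps_cvg0 sigma0 gamma01 a0 run aB (F_cvg i0)).
  (* Each [F i] converges along the sequence, so it takes the same value at [y] and at [xs]. *)
  move=> y y_cluster /isol; apply; apply/rowP => i.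
  apply: cluster_cvg_eq (F_cvg i); first exact: Rhausdorff.
  apply: (@cluster_comp _ _ x (fun y => F y 0 i)) => //.
  exact: continuous_component.
have ls_cvg : comb_gradient F ls (x k) @[k --> \oo] --> (0 : 'rV[R]_n).
  rewrite -ls_multiplier; apply: cvg_fsum => i.
  exact: cvgZl_tmp (continuous_cvg _ (grad_cont i xs) x_cvg).
have comb_x_cvg : comb_gradient F (lam k) (x k) @[k --> \oo] --> (0 : 'rV[R]_n).
  pose q k := b / a * dot (comb_gradient F ls (x k)) (comb_gradient F ls (x k)).
  have q0 : q @ \oo --> (0 : R).
    rewrite -[X in _ --> X](mulr0 (b / a)) -(dot0l (0 : 'rV[R]_n)).
    exact: cvgZl_tmp (cvg_dot ls_cvg ls_cvg).
  have comb_le k : `|comb_gradient F (lam k) (x k)| ^+ 2 <= q k.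
    apply: le_trans (sqr_mxnorm_le_dot _) _.
    have [aBk Bkb] := abB k; have [_ /(_ k)[pdB lamk _]] := run.
    exact: dual_solution_dot_le lamk ls_simplex.
  exact: cvg_sqr_norm_le comb_le q0.
have comb_cvg := comb_gradient_lam_cvg0 (fun i => grad_cont i xs) lam_simplex
  x_cvg comb_x_cvg.
have unique (l : 'rV[R]_m) : \sum_i l 0 i = 1 -> comb_gradient F l xs = 0 -> l = ls.
  have [t0 d0] := qp_solution_critical ls_simplex ls_multiplier Bs_pd ts_ds_qp.
  (* At a critical point the program has solution [(0, 0)], so every constraint is active. *)
  have actT : active_set F xs ts ds = [set: 'I_m]%SET.
    by apply/finset.setP => i; rewrite !inE t0 d0 dot0r eqxx.
  move=> l1 lc; rewrite actT in active_affine.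
  apply: affinely_independent_unique active_affine _ _.
    by rewrite l1; have [] := ls_simplex.
  exact: etrans lc (esym ls_multiplier).
have coord_cvg (l : 'rV[R]_m) i : (l' : 'rV[R]_m) 0 i @[l' --> l] --> l 0 i.
  exact: coord_continuous.
have sum_continuous : continuous (fun l : 'rV[R]_m => \sum_i l 0 i).
  by move=> l; exact: cvg_fsum (coord_cvg l).
have comb_continuous : continuous (fun l : 'rV[R]_m => comb_gradient F l xs).
  move=> l; have term i : (l' : 'rV[R]_m) 0 i *: gradient F i xs @[l' --> l] -->
      l 0 i *: gradient F i xs.
    exact: cvgZr_tmp (coord_cvg l i).
  exact: cvg_fsum term.
have lam_sum : \sum_i lam k 0 i @[k --> \oo] --> (1 : R).
  rewrite (_ : (fun k => \sum_i lam k 0 i) = cst 1); first exact: cvg_cst.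
  by apply/funext => k; have [] := lam_simplex k.
have lam_cluster l : cluster (lam @ \oo) l -> l = ls.
  move=> l_cluster; apply: unique.
    have l1 := cluster_comp (sum_continuous l) l_cluster.
    exact: cluster_cvg_eq (@Rhausdorff R) l1 lam_sum.
  have lc := cluster_comp (comb_continuous l) l_cluster.
  exact: cluster_cvg_eq (@norm_hausdorff _ _) lc comb_cvg.
apply/cvgrPdist_lt => e e0.
(* A cluster point of [lam] is [ls], which lies outside this shell; on the simplex the outer bound 1
   holds automatically. *)
have off : \forall k \near \oo, ~ (e <= `|lam k - ls| <= 1).
  apply: (compact_near_not_cluster (@compact_shell R m ls e 1)) => l /= /andP[el _].
  by move=> /lam_cluster ll; move: el; rewrite ll subrr normr0 leNgt e0.
apply: filterS off => k; rewrite simplex_dist_le1// andbT => /negP.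
by rewrite -ltNge distrC.
Unshelve. all: by end_near. Qed.
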